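(* A topological space $X$ is $\kappa$-Fréchet–Urysohn if and only if each point $x\in X$ is contained in a dense $\kappa$-Fréchet–Urysohn subspace of $X$.
   Context: A topological space $X$ is $\kappa$-Fréchet–Urysohn if for every open subset $U$ of $X$ and every $x\in\overline{U}$ there is a sequence $\{x_n\}_{n\in\mathbb N}\subseteq U$ converging to $x$. Subspaces carry the subspace topology. *)

(* Defs.v *)
From mathcomp Require Import all_boot all_classical.
From mathcomp Require Import topology.

Set Implicit Arguments.
Unset Strict Implicit.
Unset Printing Implicit Defensive.

Local Open Scope classical_set_scope.

Definition kappa_Frechet_Urysohn (X : topologicalType) : Prop :=
  forall U : set X, open U -> forall x : X, closure U x ->
    exists u : nat -> X, (forall n, U (u n)) /\ u @ \oo --> x.

(* Main.v *)
Require Import Defs.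
From mathcomp Require Import all_boot all_classical.
From mathcomp Require Import topology.

Local Open Scope classical_set_scope.

(** The property of a dense subspace [D] only speaks of limits lying in [D], but
    the subspace may be chosen after the limit point [x] of [U].
    With [x] in [D], every open neighbourhood of [x] meets [U] in a
    nonempty open set, which the dense set [D] meets again; hence [x] is in the
    closure of the trace of [U] on [D] ([closure_preimage_dense]).  A sequence
    of that trace converging to [x] in [D] also converges to [x] in the whole
    space, the inclusion being continuous.  Conversely the whole space is a
    dense subspace of itself through any point, and, seen as a subspace, it
    inherits the property, as every open subspace does
    ([kappa_Frechet_Urysohn_open_subspace]). *)

(** The subspace topology is initial for the inclusion, so convergence in it
    can be tested in the ambient space. *)
Lemma cvg_set_valP (X : topologicalType) (D : set X) (F : set_system D)
    (x : D) : Filter F -> F --> x <-> set_val @ F --> set_val x.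
Proof.
move=> FF; split=> [Fx|Fx A].
  exact: cvg_comp Fx (@initial_continuous D X set_val x).
rewrite nbhsE => -[_ [[V oV <-] Vx] VA]; apply: filterS VA _.
by apply: Fx; exact: open_nbhs_nbhs.
Qed.

(** Openness of [U] is essential: it makes the intersection of [U] with an open
    neighbourhood of the point a set that the dense [D] has to meet. *)
Lemma closure_preimage_dense (X : topologicalType) (D U : set X) (x : D) :
  dense D -> open U -> closure U (set_val x) ->
  closure (set_val @^-1` U : set D) x.
Proof.
move=> dD oU clUx A; rewrite nbhsE => -[_ [[V oV <-] Vx] VA].
have UV0 : U `&` V !=set0 by apply: clUx; exact: open_nbhs_nbhs.
have [y [[Uy Vy] Dy]] := dD _ UV0 (openI oU oV).
by exists (exist _ y (mem_set Dy)); split => //; exact: VA.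
Qed.

(** Let [V] be open in the space.  Since [D] is open as well, so is [V `&` D],
    and a sequence of [V `&` D] lifts to the subspace. *)
Lemma kappa_Frechet_Urysohn_open_subspace (X : topologicalType) (D : set X) :
  open D -> kappa_Frechet_Urysohn X -> kappa_Frechet_Urysohn D.
Proof.
move=> oD fuX _ [V oV <-] x clVx.
have clVDx : closure (V `&` D) (set_val x).
  move=> B /(@initial_continuous D X set_val x) /clVx [y [Vy By]].
  by exists (set_val y); split => //; split => //; exact: set_mem (valP y).
have [u [uVD ux]] := fuX _ (openI oV oD) _ clVDx.
exists (fun n => exist _ (u n) (mem_set (uVD n).2)); split=> [n|].
  exact: (uVD n).1.
exact/cvg_set_valP.
Qed.

(* [set_type D] is the subspace [D]: the library gives this subtype the initial
   topology of its inclusion into [X]. *)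
Theorem theorem2p1 (X : topologicalType) :
  kappa_Frechet_Urysohn X <->
  forall x : X, exists D : set X,
    [/\ D x, dense D & kappa_Frechet_Urysohn (set_type D)].
Proof.
split=> [fuX x|subX U oU x clUx].
  exists setT; split=> //; first by move=> O O0 _; rewrite setIT.
  exact: kappa_Frechet_Urysohn_open_subspace openT fuX.
have [D [Dx dD fuD]] := subX x.
pose x' : D := exist _ x (mem_set Dx).
have oUD : open (set_val @^-1` U : set D) by exists U.
have clUDx : closure (set_val @^-1` U : set D) x'.
  exact: closure_preimage_dense.
have [u [uU ux]] := fuD _ oUD _ clUDx.
exists (set_val \o u); split=> //.
exact: (iffLR (cvg_set_valP _ _ _ _ _) ux).
Qed.
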